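(* Let $M$ be a finitely copresented $R$-module, i.e. let there be an exact sequence of $R$-modules $$0\to M\xrightarrow{\varphi}R^n\xrightarrow{P}R^m .$$ Then the dual sequence $$(R^m)^\star\xrightarrow{P^\star}(R^n)^\star\xrightarrow{\varphi^\star}M^\star\to 0$$ is exact as well. In particular, $M^\star$ is finitely presented.
   Context: We work in homotopy type theory with univalent universes and propositional truncation (neither excluded middle nor the axiom of choice is assumed). ''Merely'', ''there exists'' and disjunction refer to propositional truncation; a map is surjective if its fibers are merely inhabited. Fix a commutative ring $R$. A finitely presented $R$-algebra is one merely of the form $R[X_1,\dots,X_n]/(P_1,\dots,P_l)$; for such $A$, $\mathrm{Spec}(A)$ is the type of $R$-algebra homomorphisms $A\to R$, and for $a:A$, $x:\mathrm{Spec}(A)$ one writes $a(x)=x(a)$. A Zariski-cover of $\mathrm{Spec}(A)$ is a finite family of subtypes $U_i=\{x\mid f_i(x)\text{ invertible}\}$ with $f_1,\dots,f_n:A$ generating the unit ideal. Axioms: (Locality) $R$ is local: $1\neq 0$, and if $x+y$ is invertible then $x$ or $y$ is invertible. (Duality) For every finitely presented $R$-algebra $A$ the map $A\to(\mathrm{Spec}(A)\to R)$, $a\mapsto(\varphi\mapsto\varphi(a))$ is an isomorphism of $R$-algebras. (Zariski-local choice) For every finitely presented $R$-algebra $A$ and family $B$ of merely inhabited types over $\mathrm{Spec}(A)$, there merely exist a Zariski-cover $U_1,\dots,U_n$ of $\mathrm{Spec}(A)$ and dependent functions $s_i:(x:U_i)\to B(x)$. For an $R$-module $M$, $M^\star=\mathrm{Hom}_R(M,R)$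 denotes its dual; for a linear map $f$, $f^\star$ is precomposition with $f$. An $R$-module is finitely presented if it is merely the cokernel of a linear map $R^a\to R^b$, and finitely copresented if it is merely the kernel of a linear map $R^n\to R^m$. *)

(* Defs.v *)
(* Types are Rocq types with Leibniz equality, mere propositions are elements
   of Prop, and truncated notions are the Prop-valued connectives exists, \/
   and inhabited.  The algebraic hierarchy of MathComp is unusable here: its
   structures carry decidable equality and a choice operator, which contradict
   the duality axiom below. *)
From Stdlib Require Import Ring ChoiceFacts.
From Stdlib Require Import FunctionalExtensionality ProofIrrelevance.
From mathcomp Require Import all_boot.

Set Implicit Arguments.
Unset Strict Implicit.
Unset Printing Implicit Defensive.

(* The part of the elimination of propositional truncation that Prop lacks in
   Rocq: a type with exactly one element satisfying P merely is inhabited by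
   it.  It holds in homotopy type theory, and yields neither excluded middle
   nor choice. *)
Definition unique_choice : Type := ConstructiveDefiniteDescription.

Definition surjective (X Y : Type) (f : X -> Y) : Prop :=
  forall y, exists x, f x = y.

Record commRing : Type := CommRing {
  rsort :> Type;
  rzero : rsort;
  rone : rsort;
  radd : rsort -> rsort -> rsort;
  rmul : rsort -> rsort -> rsort;
  rsub : rsort -> rsort -> rsort;
  ropp : rsort -> rsort;
  rtheory : ring_theory rzero rone radd rmul rsub ropp (@eq rsort) }.

Arguments rzero {c}.
Arguments rone {c}.

Declare Scope sag_scope.
Delimit Scope sag_scope with sag.
Notation "0" := rzero : sag_scope.
Notation "1" := rone : sag_scope.
Notation "x + y" := (radd x y) : sag_scope.
Notation "x * y" := (rmul x y) : sag_scope.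
Notation "- x" := (ropp x) : sag_scope.
Notation "\sum_ ( i < n ) F" := (\big[@radd _/rzero]_(i < n) F%sag) : sag_scope.
Local Open Scope sag_scope.

Record rhom (A B : commRing) : Type := RHom {
  rhom_fun :> A -> B;
  rhomD : forall x y, rhom_fun (x + y) = rhom_fun x + rhom_fun y;
  rhomM : forall x y, rhom_fun (x * y) = rhom_fun x * rhom_fun y;
  rhom1 : rhom_fun 1 = 1 }.

Definition invertible (A : commRing) (x : A) : Prop := exists y, x * y = 1.

Definition generates_unit_ideal (A : commRing) (n : nat) (f : 'I_n -> A) : Prop :=
  exists g : 'I_n -> A, \sum_(i < n) (g i * f i) = 1.

Definition local_ring (R : commRing) : Prop :=
  (1 : R) <> 0 /\
  forall x y : R, invertible (x + y) -> invertible x \/ invertible y.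

Record algebra (R : commRing) : Type := Algebra {
  asort :> commRing;
  astruct : rhom R asort }.

Record alghom (R : commRing) (A B : algebra R) : Type := AlgHom {
  alghom_rhom :> rhom A B;
  alghomC : forall r, alghom_rhom (astruct A r) = astruct B r }.

Definition is_alg_iso (R : commRing) (A B : algebra R) (f : alghom A B) : Prop :=
  exists g : alghom B A, cancel f g /\ cancel g f.

Definition self_alg (R : commRing) : algebra R :=
  @Algebra R R (@RHom R R id (fun _ _ => erefl) (fun _ _ => erefl) erefl).

Definition Spec (R : commRing) (A : algebra R) : Type := alghom A (self_alg R).

Lemma fun_ring_theory (X : Type) (R : commRing) :
  @ring_theory (X -> R) (fun _ => 0) (fun _ => 1)
    (fun f g x => f x + g x) (fun f g x => f x * g x)
    (fun f g x => rsub (f x) (g x)) (fun f x => - f x) eq.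
Proof.
have T := rtheory R.
by split=> *; apply: functional_extensionality => x; apply T.
Qed.

Definition fun_alg (X : Type) (R : commRing) : algebra R :=
  @Algebra R (CommRing (fun_ring_theory X R))
    (@RHom R (CommRing (fun_ring_theory X R)) (fun r _ => r)
       (fun _ _ => erefl) (fun _ _ => erefl) erefl).

Lemma eval_alg_struct (R : commRing) (A : algebra R) (r : R) :
  (fun x : Spec A => x (astruct A r)) = (fun _ => r).
Proof. by apply: functional_extensionality => x; apply: (alghomC x). Qed.

Lemma eval_alg_one (R : commRing) (A : algebra R) :
  (fun x : Spec A => x 1) = (fun _ => 1).
Proof. by apply: functional_extensionality => x; apply: (rhom1 x). Qed.

Lemma eval_alg_add (R : commRing) (A : algebra R) (a b : A) :
  (fun x : Spec A => x (a + b)) = (fun x => (x a : R) + x b).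
Proof. by apply: functional_extensionality => x; apply: (rhomD x). Qed.

Lemma eval_alg_mul (R : commRing) (A : algebra R) (a b : A) :
  (fun x : Spec A => x (a * b)) = (fun x => (x a : R) * x b).
Proof. by apply: functional_extensionality => x; apply: (rhomM x). Qed.

Definition eval_alg (R : commRing) (A : algebra R) :
    alghom A (fun_alg (Spec A) R) :=
  @AlgHom R A (fun_alg (Spec A) R)
    (@RHom A (fun_alg (Spec A) R) (fun a x => x a)
       (@eval_alg_add R A) (@eval_alg_mul R A) (eval_alg_one A))
    (@eval_alg_struct R A).

(* R[X_1, ..., X_n] is the free commutative R-algebra: ring expressions modulo
   mpol_eq, the least congruence making them a commutative R-algebra.  Normal
   forms are not available, as equality in R is not decidable. *)
Inductive mpol (R : commRing) (n : nat) : Type :=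
  | mpolC of R
  | mpolX of 'I_n
  | mpol_add of mpol R n & mpol R n
  | mpol_mul of mpol R n & mpol R n
  | mpol_opp of mpol R n.

Arguments mpolC {R n}.
Arguments mpolX {R n}.

Record mpol_congruence (R : commRing) (n : nat)
    (E : mpol R n -> mpol R n -> Prop) : Prop := MpolCongruence {
  mpol_congr_equiv : RelationClasses.Equivalence E;
  mpol_congr_ext :
    ring_eq_ext (@mpol_add R n) (@mpol_mul R n) (@mpol_opp R n) E;
  mpol_congr_ring :
    ring_theory (mpolC 0) (mpolC 1) (@mpol_add R n) (@mpol_mul R n)
      (fun p q => mpol_add p (mpol_opp q)) (@mpol_opp R n) E;
  mpol_congrD : forall r s : R,
    E (mpolC (r + s)) (mpol_add (mpolC r) (mpolC s));
  mpol_congrM : forall r s : R,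
    E (mpolC (r * s)) (mpol_mul (mpolC r) (mpolC s)) }.

Definition mpol_eq (R : commRing) (n : nat) (p q : mpol R n) : Prop :=
  forall E, mpol_congruence E -> E p q.

Definition in_ideal (R : commRing) (n l : nat) (P : 'I_l -> mpol R n)
    (p : mpol R n) : Prop :=
  exists q : 'I_l -> mpol R n,
    mpol_eq p (\big[@mpol_add R n/mpolC 0]_(j < l) mpol_mul (q j) (P j)).

Fixpoint meval (R : commRing) (A : algebra R) (n : nat) (x : 'I_n -> A)
    (p : mpol R n) : A :=
  match p with
  | mpolC r => astruct A r
  | mpolX i => x i
  | mpol_add p q => meval x p + meval x q
  | mpol_mul p q => meval x p * meval x q
  | mpol_opp p => - meval x p
  end.

(* A = R[X_1, ..., X_n]/(P_1, ..., P_l), with x i the class of X_i: evaluation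
   at x is onto A, with kernel the ideal (P_1, ..., P_l). *)
Definition is_presentation (R : commRing) (A : algebra R) (n l : nat)
    (P : 'I_l -> mpol R n) (x : 'I_n -> A) : Prop :=
  surjective (meval x) /\ (forall p, meval x p = 0 <-> in_ideal P p).

Definition fp_algebra (R : commRing) (A : algebra R) : Prop :=
  exists (n l : nat) (P : 'I_l -> mpol R n) (x : 'I_n -> A),
    is_presentation P x.

Definition duality (R : commRing) : Prop :=
  forall A : algebra R, fp_algebra A -> is_alg_iso (eval_alg A).

Definition zariski_local_choice (R : commRing) : Prop :=
  forall A : algebra R, fp_algebra A ->
  forall B : Spec A -> Type, (forall x, inhabited (B x)) ->
  exists (n : nat) (f : 'I_n -> A),
    generates_unit_ideal f /\
    inhabited (forall (i : 'I_n) (x : Spec A), invertible (x (f i)) -> B x).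

Record module (R : commRing) : Type := Module {
  msort :> Type;
  mzero : msort;
  madd : msort -> msort -> msort;
  mopp : msort -> msort;
  mscale : R -> msort -> msort;
  maddA : forall u v w, madd u (madd v w) = madd (madd u v) w;
  maddC : forall u v, madd u v = madd v u;
  madd0 : forall u, madd mzero u = u;
  maddN : forall u, madd u (mopp u) = mzero;
  mscaleA : forall a b u, mscale a (mscale b u) = mscale (a * b) u;
  mscale1 : forall u, mscale 1 u = u;
  mscaleDr : forall a u v, mscale a (madd u v) = madd (mscale a u) (mscale a v);
  mscaleDl : forall a b u, mscale (a + b) u = madd (mscale a u) (mscale b u) }.

Arguments mzero {R m}.
Arguments madd {R m}.
Arguments mopp {R m}.
Arguments mscale {R m}.

Record linmap (R : commRing) (M N : module R) : Type := LinMap {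
  linmap_fun :> M -> N;
  linmapD : forall u v, linmap_fun (madd u v) = madd (linmap_fun u) (linmap_fun v);
  linmapZ : forall a u, linmap_fun (mscale a u) = mscale a (linmap_fun u) }.

Lemma linmap_ext (R : commRing) (M N : module R) (f g : linmap M N) :
  (forall u, f u = g u) -> f = g.
Proof.
case: f g => f fD fZ [g gD gZ] /= fg.
have {}fg : f = g by apply: functional_extensionality.
by subst g; congr LinMap; apply: proof_irrelevance.
Qed.

Section DualOperations.

Variable R : commRing.
Add Ring R_ring : (rtheory R).

Definition self_mod : module R.
Proof.
by refine (@Module R R 0 (@radd R) (@ropp R) (@rmul R) _ _ _ _ _ _ _ _);
  move=> *; ring.
Defined.

(* R^n *)
Definition free_mod (n : nat) : module R.
Proof.
by refine (@Module R ('I_n -> R) (fun _ => 0) (fun u v i => u i + v i)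
     (fun u i => - u i) (fun a u i => a * u i) _ _ _ _ _ _ _ _);
  move=> *; apply: functional_extensionality => i; ring.
Defined.

Variable M : module R.

Definition dual_zero : linmap M self_mod.
Proof. by refine (@LinMap R M self_mod (fun _ => 0) _ _) => *; rewrite /=; ring. Defined.

Definition dual_add (f g : linmap M self_mod) : linmap M self_mod.
Proof.
by refine (@LinMap R M self_mod (fun u => (f u : R) + g u) _ _) => *;
  rewrite ?linmapD ?linmapZ /=; ring.
Defined.

Definition dual_opp (f : linmap M self_mod) : linmap M self_mod.
Proof.
by refine (@LinMap R M self_mod (fun u => - (f u : R)) _ _) => *;
  rewrite ?linmapD ?linmapZ /=; ring.
Defined.

Definition dual_scale (a : R) (f : linmap M self_mod) : linmap M self_mod.
Proof.
by refine (@LinMap R M self_mod (fun u => a * (f u : R)) _ _) => *;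
  rewrite ?linmapD ?linmapZ /=; ring.
Defined.

Definition dual : module R.
Proof.
by refine (@Module R (linmap M self_mod) dual_zero dual_add dual_opp dual_scale
     _ _ _ _ _ _ _ _); move=> *; apply: linmap_ext => ?; rewrite /=; ring.
Defined.

End DualOperations.

Definition linmap_comp (R : commRing) (L M N : module R)
    (g : linmap M N) (f : linmap L M) : linmap L N.
Proof.
by refine (@LinMap R L N (fun u => g (f u)) _ _) => *;
  rewrite ?linmapD ?linmapZ.
Defined.

Definition dual_map (R : commRing) (M N : module R) (f : linmap M N) :
  linmap (dual N) (dual M).
Proof.
by refine (@LinMap R (dual N) (dual M)
     (fun g : linmap N (self_mod R) => linmap_comp g f) _ _) => *;
  apply: linmap_ext.
Defined.

Definition exact_at (R : commRing) (L M N : module R)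
    (f : linmap L M) (g : linmap M N) : Prop :=
  forall u : M, g u = mzero <-> exists v : L, f v = u.

(* M is the cokernel of f : R^a -> R^b. *)
Definition fp_module (R : commRing) (M : module R) : Prop :=
  exists (a b : nat) (f : linmap (free_mod R a) (free_mod R b))
    (g : linmap (free_mod R b) M), exact_at f g /\ surjective g.

(* Main.v *)
From HB Require Import structures.
From Stdlib Require Import Ring.
From Stdlib Require Import FunctionalExtensionality PropExtensionality ProofIrrelevance.
From mathcomp Require Import all_boot.
Require Import Defs.

Set Implicit Arguments.
Unset Strict Implicit.
Unset Printing Implicit Defensive.

Local Open Scope sag_scope.

(** Let A = R[X_1, ..., X_n]/(P_1, ..., P_m), the P_j being the linear forms that
    are the rows of P.  A point of Spec A is a common zero in R^n of the P_j,
    that is, an element of M.  By duality, then, every function M -> R is given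
    by a polynomial, and a polynomial vanishing on M lies in the ideal
    (P_1, ..., P_m): these are function_polynomial and in_ideal_vanishing.  It
    remains to see that for linear functions the polynomials can be taken
    linear.  The device for extracting linear parts is evaluation in the dual
    numbers R[e], e^2 = 0: the value p(e u) is p(0) + e p_1(u), with p_1 the
    linear part of p.

    Exactness at the dual of R^n (annihilator_of_kernel).  A linear form g that
    vanishes on M is, as a polynomial, a combination of the P_j with polynomial
    coefficients q_j.  Evaluating at e u gives g(u) = sum_j q_j(0) P_j(u), so g
    factors through P.

    Surjectivity onto the dual of M (extend_functional).  Let f : M -> R be
    linear, and p a polynomial that agrees with f on M.  For v in M and t in R
    one has p(t v) = f(t v) = t f(v), so the polynomial p(T v) - T f(v) in one
    variable vanishes on all of R; by duality for R[T] it is zero.  Evaluating it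
    at T = e gives p_1(v) = f(v), and p_1 is a linear form on R^n extending f.

    The finite presentation of the dual of M follows, as R^n is isomorphic to
    its dual.  Unique choice enters where a function is given by its graph: the map
    that sends a zero of the P_j to the element of M above it, the points of
    Spec A, and the operations on the quotient A. *)

(** * Finite sums and linear forms *)

Lemma raddA (R : commRing) : associative (@radd R).
Proof. exact: (Radd_assoc (rtheory R)). Qed.

Lemma raddC (R : commRing) : commutative (@radd R).
Proof. exact: (Radd_comm (rtheory R)). Qed.

Lemma radd0 (R : commRing) : left_id 0 (@radd R).
Proof. exact: (Radd_0_l (rtheory R)). Qed.

HB.instance Definition _ (R : commRing) :=
  Monoid.isComLaw.Build R 0 (@radd R) (@raddA R) (@raddC R) (@radd0 R).

Section Sums.

Variable R : commRing.
Add Ring R_ring_sums : (rtheory R).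

Lemma raddIr (a b : R) : a + b = b -> a = 0.
Proof. by move=> ab; have -> : a = (a + b) + - b by [ring]; rewrite ab; ring. Qed.

Lemma rmulr0 (a : R) : a * 0 = 0.
Proof. ring. Qed.

Lemma rsubr0_eq (a b : R) : a + - b = 0 -> a = b.
Proof. by move=> ab; have -> : a = (a + - b) + b by [ring]; rewrite ab; ring. Qed.

Lemma rsum_distrr (n : nat) (a : R) (F : 'I_n -> R) :
  a * \sum_(i < n) F i = \sum_(i < n) (a * F i).
Proof. by apply: (big_morph (rmul a)) => [x y|]; ring. Qed.

End Sums.

Section Homs.

Variables (A B : commRing) (h : rhom A B).
Add Ring A_ring_homs : (rtheory A).
Add Ring B_ring_homs : (rtheory B).

Lemma rhom0 : h 0 = 0.
Proof. by apply: (@raddIr _ _ (h 0)); rewrite -rhomD; congr (h _); ring. Qed.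

Lemma rhomN (a : A) : h (- a) = - h a.
Proof.
have e : h (- a) + h a = 0 by rewrite -rhomD -rhom0; congr (h _); ring.
by have -> : h (- a) = (h (- a) + h a) + - h a by [ring]; rewrite e; ring.
Qed.

End Homs.

Section LinearForms.

Variable R : commRing.
Add Ring R_ring_forms : (rtheory R).

Lemma maddIr (M : module R) (u v : M) : madd u v = v -> u = mzero.
Proof. by move=> uv; rewrite -[u]madd0 maddC -(maddN v) maddA uv. Qed.

Lemma linmap0 (M N : module R) (f : linmap M N) : f mzero = mzero.
Proof. by apply: (@maddIr _ _ (f mzero)); rewrite -linmapD madd0. Qed.

Definition basis (n : nat) (i : 'I_n) : free_mod R n :=
  fun k => if k == i then 1 else 0.

Definition dot (n : nat) (c : 'I_n -> R) : linmap (free_mod R n) (self_mod R).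
Proof.
refine (@LinMap R (free_mod R n) (self_mod R)
  (fun u => \sum_(i < n) (c i * u i)) _ _) => [u v|a u] /=.
  by rewrite -big_split; apply: eq_bigr => i _ /=; ring.
by rewrite rsum_distrr; apply: eq_bigr => i _; ring.
Defined.

Definition coord (n : nat) (j : 'I_n) : linmap (free_mod R n) (self_mod R) :=
  @LinMap R (free_mod R n) (self_mod R) (fun u => u j)
    (fun _ _ => erefl) (fun _ _ => erefl).

Lemma free_mod_sumE (n : nat) (u : free_mod R n) :
  u = \big[madd/mzero]_(i < n) mscale (u i) (basis i).
Proof.
apply: functional_extensionality => k.
rewrite (@big_morph _ _ (fun v : free_mod R n => v k) 0 (@radd R)) //=.
rewrite (bigD1 k) //= big1 ?/basis ?eqxx => [|i /negbTE ik]; first by ring.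
by rewrite eq_sym ik; ring.
Qed.

Lemma linmap_dotE (n : nat) (f : linmap (free_mod R n) (self_mod R)) u :
  f u = dot (fun i => f (basis i)) u.
Proof.
rewrite {1}[u]free_mod_sumE.
rewrite (@big_morph _ _ f 0 (@radd R)); first last.
- exact: (linmap0 f).
- by move=> *; rewrite linmapD.
by apply: eq_bigr => i _; rewrite linmapZ /=; ring.
Qed.

End LinearForms.

(** * Duals of free modules *)

Section DualOfFree.

Variable R : commRing.
Add Ring R_ring_dual : (rtheory R).

Lemma dot_basis (n : nat) (c : 'I_n -> R) (i : 'I_n) : dot c (basis R i) = c i.
Proof.
rewrite /= (bigD1 i) //= big1 ?/basis ?eqxx => [|k /negbTE ->]; ring.
Qed.

Definition to_dual (n : nat) :
  linmap (free_mod R n) (dual (free_mod R n)).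
Proof.
refine (@LinMap R (free_mod R n) (dual (free_mod R n)) (@dot R n) _ _)
  => [c d|a c]; apply: linmap_ext => u /=.
  by rewrite -big_split; apply: eq_bigr => i _ /=; ring.
by rewrite rsum_distrr; apply: eq_bigr => i _; ring.
Defined.

Definition of_dual (n : nat) :
  linmap (dual (free_mod R n)) (free_mod R n) :=
  @LinMap R (dual (free_mod R n)) (free_mod R n)
    (fun (f : linmap (free_mod R n) (self_mod R)) i => f (basis R i))
    (fun _ _ => erefl) (fun _ _ => erefl).

Lemma to_dualK (n : nat) : cancel (@to_dual n) (@of_dual n).
Proof. by move=> c; apply: functional_extensionality => i; apply: dot_basis. Qed.

Lemma of_dualK (n : nat) : cancel (@of_dual n) (@to_dual n).
Proof. by move=> f; apply: linmap_ext => u; rewrite [RHS]linmap_dotE. Qed.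

(** A presentation by duals of free modules is a presentation, by transport
    along the isomorphism of R^n with its dual. *)
Lemma fp_module_of_duals (M : module R) (n m : nat)
    (f : linmap (dual (free_mod R m)) (dual (free_mod R n)))
    (g : linmap (dual (free_mod R n)) M) :
  exact_at f g -> surjective g -> fp_module M.
Proof.
move=> fg g_surj.
exists m, n, (linmap_comp (@of_dual n) (linmap_comp f (@to_dual m))),
  (linmap_comp g (@to_dual n)); split=> [c|y]; last first.
  have [h <-] := g_surj y; exists (@of_dual n h).
  exact: (congr1 g (of_dualK h)).
rewrite -[linmap_comp _ _ c]/(g (@to_dual n c)) fg; split=> [[h fh]|[d <-]].
  exists (@of_dual m h).
  rewrite -[LHS]/(@of_dual n (f (@to_dual m (@of_dual m h)))).
  by rewrite of_dualK fh to_dualK.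
by exists (@to_dual m d); symmetry; apply: of_dualK.
Qed.

End DualOfFree.

(** * Polynomials and their ideals *)

Section Polynomials.

Variables (R : commRing) (n : nat).

Lemma meval_sum (A : algebra R) (x : 'I_n -> A) (k : nat) (F : 'I_k -> mpol R n) :
  meval x (\big[@mpol_add R n/mpolC 0]_(i < k) F i) = \sum_(i < k) meval x (F i).
Proof. by apply: (big_morph (meval x)) => //=; apply: rhom0. Qed.

(** Equality under evaluation at x is itself one of the congruences that mpol_eq
    is the least of. *)
Lemma mpol_eq_meval (A : algebra R) (x : 'I_n -> A) (p q : mpol R n) :
  mpol_eq p q -> meval x p = meval x q.
Proof.
move/(_ (fun p q => meval x p = meval x q)); apply; have T := rtheory A; split.
- by split=> [p1|p1 q1 ->|p1 q1 r1 -> ->].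
- by split=> [p1 p2 e q1 q2 e'|p1 p2 e q1 q2 e'|p1 p2 e] /=; rewrite e ?e'.
- by split=> *; rewrite /= ?(rhom0, rhom1) //; apply T.
- by move=> r s /=; rewrite rhomD.
- by move=> r s /=; rewrite rhomM.
Qed.

Lemma mpol_eq_congruence : mpol_congruence (@mpol_eq R n).
Proof.
split.
- split=> [p E HE|p q pq E HE|p q r pq qr E HE];
    have [? ? ?] := mpol_congr_equiv HE; first by [].
    by symmetry; apply: pq.
  by transitivity q; [apply: pq|apply: qr].
- split=> [p p' e q q' e' E HE|p p' e q q' e' E HE|p p' e E HE].
  + exact: (Radd_ext (mpol_congr_ext HE) _ _ (e E HE) _ _ (e' E HE)).
  + exact: (Rmul_ext (mpol_congr_ext HE) _ _ (e E HE) _ _ (e' E HE)).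
  + exact: (Ropp_ext (mpol_congr_ext HE) _ _ (e E HE)).
- by split=> * E HE; apply (mpol_congr_ring HE).
- by move=> r s E HE; apply: mpol_congrD.
- by move=> r s E HE; apply: mpol_congrM.
Qed.

#[local] Instance mpol_eq_equiv : RelationClasses.Equivalence (@mpol_eq R n) :=
  mpol_congr_equiv mpol_eq_congruence.
#[local] Instance mpol_eq_addE :
    Morphisms.Proper (Morphisms.respectful (@mpol_eq R n)
      (Morphisms.respectful (@mpol_eq R n) (@mpol_eq R n))) (@mpol_add R n) :=
  Radd_ext (mpol_congr_ext mpol_eq_congruence).
#[local] Instance mpol_eq_mulE :
    Morphisms.Proper (Morphisms.respectful (@mpol_eq R n)
      (Morphisms.respectful (@mpol_eq R n) (@mpol_eq R n))) (@mpol_mul R n) :=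
  Rmul_ext (mpol_congr_ext mpol_eq_congruence).
Add Ring mpol_setoid_ring : (mpol_congr_ring mpol_eq_congruence)
  (setoid mpol_eq_equiv (mpol_congr_ext mpol_eq_congruence)).

Section Ideal.

Variables (l : nat) (P : 'I_l -> mpol R n).

Lemma in_ideal_eq (p q : mpol R n) : mpol_eq p q -> in_ideal P q -> in_ideal P p.
Proof. by move=> pq [c qE]; exists c; rewrite pq. Qed.

Lemma in_idealM (a p : mpol R n) : in_ideal P p -> in_ideal P (mpol_mul a p).
Proof.
case=> c pE; exists (fun j => mpol_mul a (c j)); rewrite pE {p pE}.
apply: (big_rec2 (fun s t => mpol_eq (mpol_mul a s) t)) => [|j s t _ <-]; ring.
Qed.

Lemma in_ideal0 : in_ideal P (mpolC 0).
Proof.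
exists (fun _ => mpolC 0).
by apply: (big_rec (mpol_eq (mpolC 0))) => [|j s _ <-]; ring.
Qed.

Lemma in_idealD (p q : mpol R n) :
  in_ideal P p -> in_ideal P q -> in_ideal P (mpol_add p q).
Proof.
case=> [c pE] [d qE]; exists (fun j => mpol_add (c j) (d j)); rewrite pE qE.
apply: (big_rec3 (fun s t r => mpol_eq (mpol_add s t) r)) => [|j s t r _ <-];
  ring.
Qed.

End Ideal.

Lemma in_ideal_gen (l : nat) (P : 'I_l -> mpol R n) (j : 'I_l) :
  in_ideal P (P j).
Proof.
exists (fun i => mpolC (if i == j then 1 else 0)); symmetry.
elim: l P j => [|l IH] P j; first by case: j.
rewrite big_ord_recl; case: (unliftP ord0 j) => [i ->|->].
  have -> : mpol_eq (\big[@mpol_add R n/mpolC 0]_(k < l)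
      mpol_mul (mpolC (if lift ord0 k == lift ord0 i then 1 else 0))
        (P (lift ord0 k))) (P (lift ord0 i)).
    under eq_bigr do rewrite (inj_eq lift_inj).
    exact: (IH (fun k => P (lift ord0 k))).
  by rewrite (_ : (ord0 == _) = false) //; ring.
have -> : mpol_eq (\big[@mpol_add R n/mpolC 0]_(i < l)
    mpol_mul (mpolC (if lift ord0 i == ord0 then 1 else 0)) (P (lift ord0 i)))
  (mpolC 0).
  apply: (big_rec (fun s => mpol_eq s (mpolC 0))) => [|i s _ ->]; first by ring.
  by rewrite (eq_sym _ ord0) (negbTE (neq_lift _ _)); ring.
by rewrite eqxx; ring.
Qed.

(** The congruence whose quotient is the algebra presented by P. *)
Definition ideal_eq (l : nat) (P : 'I_l -> mpol R n) (p q : mpol R n) : Prop :=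
  in_ideal P (mpol_add p (mpol_opp q)).

Lemma mpol_eq_ideal_eq (l : nat) (P : 'I_l -> mpol R n) (p q : mpol R n) :
  mpol_eq p q -> ideal_eq P p q.
Proof.
by move=> pq; apply: in_ideal_eq (in_ideal0 P); rewrite pq; ring.
Qed.

Lemma ideal_eq_congruence (l : nat) (P : 'I_l -> mpol R n) :
  mpol_congruence (ideal_eq P).
Proof.
have IM a p := @in_idealM _ P a p; have ID := @in_idealD _ P.
split.
- split=> [p|p q pq|p q r pq qr].
  + by apply: mpol_eq_ideal_eq; ring.
  + by apply: in_ideal_eq (IM (mpol_opp (mpolC 1)) _ pq); ring.
  + by apply: in_ideal_eq (ID _ _ pq qr); ring.
- split=> [p p' e q q' e'|p p' e q q' e'|p p' e].
  + by apply: in_ideal_eq (ID _ _ e e'); ring.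
  + by apply: in_ideal_eq (ID _ _ (IM q _ e) (IM p' _ e')); ring.
  + by apply: in_ideal_eq (IM (mpol_opp (mpolC 1)) _ e); ring.
- by split=> *; apply: mpol_eq_ideal_eq; ring.
- by move=> r s; apply: mpol_eq_ideal_eq (mpol_congrD mpol_eq_congruence r s).
- by move=> r s; apply: mpol_eq_ideal_eq (mpol_congrM mpol_eq_congruence r s).
Qed.

Lemma ideal_eq0 (l : nat) (P : 'I_l -> mpol R n) (p : mpol R n) :
  ideal_eq P p (mpolC 0) <-> in_ideal P p.
Proof. by split; apply: in_ideal_eq; ring. Qed.

End Polynomials.

(** * Quotients and presented algebras *)

Section Quotient.

Variables (description : unique_choice) (T : Type) (E : T -> T -> Prop).
Hypothesis E_equiv : RelationClasses.Equivalence E.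

(** Built from equivalence classes, so that equivalent elements become equal in
    the sense of Leibniz, as the laws of a commRing require. *)
Definition quotient : Type := {c : T -> Prop | exists p, c = E p}.

Definition pi (p : T) : quotient := exist _ (E p) (ex_intro _ p erefl).

Lemma pi_surj : surjective pi.
Proof.
by case=> c [p cE]; exists p; subst c; congr exist; apply: proof_irrelevance.
Qed.

Lemma pi_eq (p q : T) : pi p = pi q <-> E p q.
Proof.
have [refl sym trans] := E_equiv; split=> [e|pq].
  by have -> : E p = E q by [case: e]; apply: refl.
have {}pq : E p = E q.
  apply: functional_extensionality => r; apply: propositional_extensionality.
  by split; [apply: trans (sym _ _ pq)|apply: trans pq].
by rewrite /pi; move: (ex_intro _ p _); rewrite pq => e; congr exist;
  apply: proof_irrelevance.
Qed.

(** The value at a class c is the unique y that is the image of some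
    representative of c: no representative is chosen. *)
Lemma quotient_rec (Y : Type) (f : T -> Y) :
  (forall p q, E p q -> f p = f q) -> {g : quotient -> Y | forall p, g (pi p) = f p}.
Proof.
move=> fE.
have val (c : quotient) : {y | exists p, pi p = c /\ f p = y}.
  apply: description; have [p <-] := pi_surj c; exists (f p).
  by split=> [|y [q [/pi_eq/fE <-]]] //; exists p.
exists (fun c => sval (val c)) => p.
by case: (val (pi p)) => y /= [q [/pi_eq/fE <-]].
Qed.

Lemma quotient_map (f : T -> T) :
  (forall p p', E p p' -> E (f p) (f p')) ->
  {g : quotient -> quotient | forall p, g (pi p) = pi (f p)}.
Proof. by move=> fE; apply: quotient_rec => p q /fE/pi_eq. Qed.

(** With one argument p fixed, f descends to a map of the quotient, and the
    family of these maps is itself compatible with E: two uses of the recursion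
    principle. *)
Lemma quotient_map2 (f : T -> T -> T) :
  (forall p p', E p p' -> forall q q', E q q' -> E (f p q) (f p' q')) ->
  {g : quotient -> quotient -> quotient | forall p q, g (pi p) (pi q) = pi (f p q)}.
Proof.
move=> fE; have refl p : E p p by case: E_equiv => refl _ _; apply: refl.
have row p := quotient_map (fun q q' qq' => fE p p (refl p) q q' qq').
have [p p' pp'|g gE] := @quotient_rec (quotient -> quotient) (fun p => sval (row p)).
  apply: functional_extensionality => c; have [q <-] := pi_surj c.
  by rewrite (svalP (row p)) (svalP (row p')); apply/pi_eq/fE.
by exists g => p q; rewrite gE (svalP (row p)).
Qed.

End Quotient.

Section Presentations.

Variables (description : unique_choice) (R : commRing) (n : nat).

Lemma congruence_quotient (E : mpol R n -> mpol R n -> Prop) :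
  mpol_congruence E ->
  exists (A : algebra R) (x : 'I_n -> A),
    surjective (meval x) /\ forall p q, meval x p = meval x q <-> E p q.
Proof.
case=> eqE extE ringE CD CM.
have piE := pi_eq eqE.
have [add addE] := quotient_map2 description eqE (Radd_ext extE).
have [mul mulE] := quotient_map2 description eqE (Rmul_ext extE).
have [opp oppE] := quotient_map description eqE (Ropp_ext extE).
have T : ring_theory (pi E (mpolC 0)) (pi E (mpolC 1)) add mul
    (fun c d => add c (opp d)) opp eq.
  split; repeat (move=> c; have [? <-] := pi_surj c; clear c);
    by rewrite ?(addE, mulE, oppE) //; apply/piE; apply ringE.
pose Q := CommRing T.
have cD (r s : R) : pi E (mpolC (r + s)) = radd (pi E (mpolC r) : Q) (pi E (mpolC s)).
  by rewrite /= addE; apply/piE.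
have cM (r s : R) : pi E (mpolC (r * s)) = rmul (pi E (mpolC r) : Q) (pi E (mpolC s)).
  by rewrite /= mulE; apply/piE.
pose A := @Algebra R Q (@RHom R Q (fun r => pi E (mpolC r)) cD cM erefl).
exists A, (fun i => pi E (mpolX i)).
have mevalE p : @meval R A n (fun i => pi E (mpolX i)) p = pi E p.
  by elim: p => //= [p -> q ->|p -> q ->|p ->].
by split=> [c|p q]; [have [p <-] := pi_surj c; exists p|rewrite !mevalE].
Qed.

Lemma presentation_exists (l : nat) (P : 'I_l -> mpol R n) :
  exists (A : algebra R) (x : 'I_n -> A), is_presentation P x.
Proof.
have [A [x [x_surj xE]]] := congruence_quotient (ideal_eq_congruence P).
exists A, x; split=> // p; rewrite -ideal_eq0 -xE /=.
by rewrite rhom0.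
Qed.

Lemma alghom_meval (A B : algebra R) (h : alghom A B) (x : 'I_n -> A) p :
  h (meval x p) = meval (fun i => h (x i)) p.
Proof.
elim: p => [r|i|p IHp q IHq|p IHp q IHq|p IHp] //=.
- exact: alghomC.
- by rewrite rhomD IHp IHq.
- by rewrite rhomM IHp IHq.
- by rewrite rhomN IHp.
Qed.

Lemma in_ideal_meval (l : nat) (P : 'I_l -> mpol R n) (A : algebra R)
    (x : 'I_n -> A) (p : mpol R n) :
  (forall j, meval x (P j) = 0) -> in_ideal P p -> meval x p = 0.
Proof.
move=> xP [q /mpol_eq_meval ->]; rewrite meval_sum big1 // => j _ /=.
by rewrite xP rmulr0.
Qed.

End Presentations.

(** * Points of the spectrum and duality *)

Section Duality.

Variables (description : unique_choice) (R : commRing) (n l : nat).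
Variable P : 'I_l -> mpol R n.

Definition common_zero (y : 'I_n -> R) : Prop :=
  forall j, @meval R (self_alg R) n y (P j) = 0.

Lemma common_zero_Spec (A : algebra R) (x : 'I_n -> A) (z : Spec A) :
  is_presentation P x -> common_zero (fun i => z (x i)).
Proof.
case=> _ xP j; rewrite -alghom_meval.
have /xP -> : in_ideal P (P j) by apply: in_ideal_gen.
exact: rhom0.
Qed.

(** The universal property of a presentation.  The value of the homomorphism at
    a is the value at y of any polynomial representing a; this is independent of
    the representative because y is a zero of the ideal. *)
Lemma Spec_common_zero (A : algebra R) (x : 'I_n -> A) (y : 'I_n -> R) :
  is_presentation P x -> common_zero y -> exists z : Spec A, (fun i => z (x i)) = y.
Proof.
case=> x_surj xP yP.
have eval_eq p q : meval x p = meval x q ->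
    @meval R (self_alg R) n y p = @meval R (self_alg R) n y q.
  move=> pq; have /xP/(in_ideal_meval yP) /= e : meval x (mpol_add p (mpol_opp q)) = 0.
    by rewrite /= pq; apply: (Ropp_def (rtheory A)).
  exact: rsubr0_eq e.
have val (a : A) : {r : R | exists p, meval x p = a /\ @meval R (self_alg R) n y p = r}.
  apply: description; have [p <-] := x_surj a.
  exists (@meval R (self_alg R) n y p); split; first by exists p.
  by move=> r [q [/eval_eq <-]].
have valE p : sval (val (meval x p)) = @meval R (self_alg R) n y p.
  by case: (val (meval x p)) => r /= [q [/eval_eq <-]].
have vD a b : sval (val (a + b)) = sval (val a) + sval (val b).
  have [[p <-] [q <-]] := (x_surj a, x_surj b).
  by rewrite -[_ + _]/(meval x (mpol_add p q)) !valE.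
have vM a b : sval (val (a * b)) = sval (val a) * sval (val b).
  have [[p <-] [q <-]] := (x_surj a, x_surj b).
  by rewrite -[_ * _]/(meval x (mpol_mul p q)) !valE.
have vC r : sval (val (astruct A r)) = r by apply: (valE (mpolC r)).
have v1 : sval (val 1) = 1 by rewrite -(rhom1 (astruct A)) vC.
exists (@AlgHom R A (self_alg R) (@RHom A R (fun a => sval (val a)) vD vM v1) vC).
by apply: functional_extensionality => i; apply: (valE (mpolX i)).
Qed.

Hypothesis R_duality : duality R.

(** Injectivity of A -> (Spec A -> R), for A the algebra presented by P.  A
    Nullstellensatz for ideals that need not be radical. *)
Lemma in_ideal_vanishing (p : mpol R n) :
  (forall y, common_zero y -> @meval R (self_alg R) n y p = 0) -> in_ideal P p.
Proof.
move=> pP; have [A [x xP]] := presentation_exists description P.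
have [g [gK _]] := R_duality (ex_intro _ n (ex_intro _ l (ex_intro _ P (ex_intro _ x xP)))).
apply/(proj2 xP)/(can_inj gK); apply: functional_extensionality => z /=.
by rewrite alghom_meval pP ?rhom0 //; apply: common_zero_Spec.
Qed.

(** Surjectivity of A -> (Spec A -> R), for A the algebra presented by P. *)
Lemma function_polynomial (F : forall y, common_zero y -> R) :
  exists p, forall y (yP : common_zero y), F y yP = @meval R (self_alg R) n y p.
Proof.
have [A [x xP]] := presentation_exists description P.
have [g [_ gK]] := R_duality (ex_intro _ n (ex_intro _ l (ex_intro _ P (ex_intro _ x xP)))).
pose G (z : Spec A) := F _ (common_zero_Spec z xP).
have [p pE] := proj1 xP (g G); exists p => y yP.
have [z zy] := Spec_common_zero xP yP; subst y.
have -> : F _ yP = G z by congr F; apply: proof_irrelevance.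
have <- : eval_alg A (g G) z = G z by rewrite gK.
by rewrite /= -pE alghom_meval.
Qed.

End Duality.

(** * Linear parts via dual numbers *)

Section LinearPart.

Variable R : commRing.
Add Ring R_ring_linear_part : (rtheory R).

(** The pair (a, b) stands for a + b e, with e^2 = 0. *)
Lemma dual_numbers_theory : @ring_theory (R * R) (0, 0) (1, 0)
  (fun a b => (a.1 + b.1, a.2 + b.2))
  (fun a b => (a.1 * b.1, a.1 * b.2 + a.2 * b.1))
  (fun a b => (a.1 + - b.1, a.2 + - b.2)) (fun a => (- a.1, - a.2)) eq.
Proof.
split=> *;
  repeat match goal with a : (_ * _)%type |- _ => destruct a end => /=;
  apply: (f_equal2 pair); ring.
Qed.

Definition dual_numbers_ring : commRing := CommRing dual_numbers_theory.

Definition dual_numbers : algebra R.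
Proof.
refine (@Algebra R dual_numbers_ring
  (@RHom R dual_numbers_ring (fun r => (r, 0)) _ _ erefl)) => r s /=;
  by congr pair; ring.
Defined.

Variable n : nat.

(** The point e u. *)
Definition infinitesimal (u : 'I_n -> R) : 'I_n -> dual_numbers :=
  fun i => (0, u i).

Lemma meval_infinitesimal_fst (u : 'I_n -> R) (p : mpol R n) :
  (meval (infinitesimal u) p).1 = @meval R (self_alg R) n (fun _ => 0) p.
Proof. by elim: p => //= [p -> q ->|p -> q ->|p ->]. Qed.

(** The coefficient of e in p(e u) is linear in u by induction on p: in a
    product, e^2 = 0 leaves only q(0) times the linear part of p and p(0) times
    that of q. *)
Definition linear_part (p : mpol R n) : linmap (free_mod R n) (self_mod R).
Proof.
refine (@LinMap R (free_mod R n) (self_mod R)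
  (fun u => (meval (infinitesimal u) p).2) _ _) => [u v|a u].
  elim: p => [r|i|p IHp q IHq|p IHp q IHq|p IHp] /=; rewrite ?IHp ?IHq;
    rewrite ?meval_infinitesimal_fst /=; ring.
elim: p => [r|i|p IHp q IHq|p IHp q IHq|p IHp] /=; rewrite ?IHp ?IHq;
    rewrite ?meval_infinitesimal_fst /=; ring.
Defined.

Definition linear_form (c : 'I_n -> R) : mpol R n :=
  \big[@mpol_add R n/mpolC 0]_(i < n) mpol_mul (mpolC (c i)) (mpolX i).

Lemma meval_linear_form (A : algebra R) (x : 'I_n -> A) (c : 'I_n -> R) :
  meval x (linear_form c) = \sum_(i < n) (astruct A (c i) * x i).
Proof. exact: meval_sum. Qed.

Lemma dual_numbers_sum (k : nat) (F : 'I_k -> dual_numbers) :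
  \sum_(i < k) F i = (\sum_(i < k) (F i).1, \sum_(i < k) (F i).2) :> dual_numbers.
Proof.
rewrite [LHS]surjective_pairing.
by congr pair; apply: (big_morph (fun a : dual_numbers => _ a)).
Qed.

Lemma infinitesimal_linear_form (u c : 'I_n -> R) :
  meval (infinitesimal u) (linear_form c) = (0, dot c u) :> dual_numbers.
Proof.
rewrite meval_linear_form dual_numbers_sum; congr pair.
  by rewrite big1 // => i _ /=; ring.
by apply: eq_bigr => i _ /=; ring.
Qed.

Fixpoint msubst (k : nat) (s : 'I_n -> mpol R k) (p : mpol R n) : mpol R k :=
  match p with
  | mpolC r => mpolC r
  | mpolX i => s i
  | mpol_add p q => mpol_add (msubst s p) (msubst s q)
  | mpol_mul p q => mpol_mul (msubst s p) (msubst s q)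
  | mpol_opp p => mpol_opp (msubst s p)
  end.

Lemma meval_subst (A : algebra R) (k : nat) (x : 'I_k -> A)
    (s : 'I_n -> mpol R k) (p : mpol R n) :
  meval x (msubst s p) = meval (fun i => meval x (s i)) p.
Proof. by elim: p => //= [p -> q ->|p -> q ->|p ->]. Qed.

End LinearPart.

(** * Functionals on a kernel *)

Section Copresented.

Variables (description : unique_choice) (R : commRing) (R_duality : duality R).
Variables (M : module R) (n m : nat).
Variables (phi : linmap M (free_mod R n)) (P : linmap (free_mod R n) (free_mod R m)).
Hypothesis phi_injective : ssrfun.injective phi.
Hypothesis phi_P_exact : exact_at phi P.
Add Ring R_ring_copresented : (rtheory R).

Definition row (j : 'I_m) (i : 'I_n) : R := P (basis R i) j.

Lemma rowE (u : free_mod R n) (j : 'I_m) : dot (row j) u = P u j.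
Proof. by symmetry; apply: (linmap_dotE (linmap_comp (coord R j) P)). Qed.

Definition equations (j : 'I_m) : mpol R n := linear_form (row j).

Lemma equations_zero (u : free_mod R n) :
  common_zero equations u <-> exists v, phi v = u.
Proof.
rewrite -phi_P_exact; split=> [uP|Pu j].
  apply: functional_extensionality => j.
  by rewrite -rowE -[RHS](uP j) /equations meval_linear_form.
by rewrite /equations meval_linear_form -[LHS]/(dot (row j) u) rowE Pu.
Qed.

(** The polynomial g lies in the ideal of the rows of P; comparing linear parts,
    only the constant terms of the polynomial coefficients contribute. *)
Lemma annihilator_of_kernel (g : linmap (free_mod R n) (self_mod R)) :
  (forall v, g (phi v) = 0) -> exists c : 'I_m -> R, forall u, g u = dot c (P u).
Proof.
move=> g0; pose p := linear_form (fun i => g (basis R i)).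
have [y yP|q pE] := in_ideal_vanishing description R_duality (P := equations) (p := p).
  have [v <-] := (equations_zero y).1 yP.
  by rewrite meval_linear_form; have := g0 v; rewrite (linmap_dotE g).
exists (fun j => @meval R (self_alg R) n (fun _ => 0) (q j)) => u.
have := mpol_eq_meval (infinitesimal u) pE.
rewrite infinitesimal_linear_form meval_sum dual_numbers_sum => -[_ e].
rewrite [g u]linmap_dotE; apply: (etrans e); apply: eq_bigr => j _ /=.
by rewrite infinitesimal_linear_form rowE meval_infinitesimal_fst /=; ring.
Qed.

(** The extension is the linear part of a polynomial representing f; homogeneity
    of f along the line through v makes it agree with f at v. *)
Lemma extend_functional (f : linmap M (self_mod R)) :
  exists g : linmap (free_mod R n) (self_mod R), forall v, g (phi v) = f v.
Proof.
have pre u (uP : common_zero equations u) : {v | phi v = u}.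
  apply: description; have [v vu] := (equations_zero u).1 uP; exists v.
  by split=> // w wu; apply: phi_injective; rewrite vu wu.
have [p pE] := function_polynomial description R_duality (fun u uP => f (sval (pre u uP))).
have fE v : f v = @meval R (self_alg R) n (phi v) p.
  have vP : common_zero equations (phi v) by apply/equations_zero; exists v.
  rewrite -(pE _ vP); congr (f _); apply: phi_injective.
  by rewrite (svalP (pre _ vP)).
exists (linear_part p) => v.
(* q is p(T v) - T f(v); it vanishes at every point of the affine line. *)
pose t : mpol R 1 := mpolX ord0.
pose q := mpol_add (msubst (fun i => mpol_mul (mpolC (phi v i)) t) p)
  (mpol_opp (mpol_mul (mpolC (f v)) t)).
have q0 : in_ideal (fun _ : 'I_0 => mpolC 0) q.
  apply: (in_ideal_vanishing description R_duality) => y _.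
  rewrite /= meval_subst /=.
  have -> : (fun i => phi v i * y ord0) = phi (mscale (y ord0) v).
    by rewrite linmapZ; apply: functional_extensionality => i /=; ring.
  by rewrite -fE linmapZ /=; ring.
(* The coefficient of e in q(e) = 0 is the linear part of p at v, minus f(v). *)
have /= := @in_ideal_meval _ _ _ (fun _ : 'I_0 => mpolC 0) _
  (infinitesimal (fun _ => 1)) q (fun _ => erefl) q0.
rewrite meval_subst /=; set x := (x in meval x p) => -[_].
have -> : x = infinitesimal (phi v).
  by apply: functional_extensionality => i /=; congr pair; ring.
move=> e; apply: rsubr0_eq; rewrite -[RHS]e /=; congr (_ + _); ring.
Qed.

End Copresented.

Theorem lemma2p3p9
  (description : unique_choice)
  (R : commRing)
  (R_local : local_ring R)
  (R_duality : duality R)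
  (R_choice : zariski_local_choice R)
  (M : module R) (n m : nat)
  (phi : linmap M (free_mod R n)) (P : linmap (free_mod R n) (free_mod R m))
  (phi_injective : ssrfun.injective phi)
  (phi_P_exact : exact_at phi P) :
  (exact_at (dual_map P) (dual_map phi) /\ surjective (dual_map phi))
  /\ fp_module (dual M).
Proof.
have dual_exact : exact_at (dual_map P) (dual_map phi).
  move=> g; split=> [g0|[h <-]].
    have [v|c gE] := annihilator_of_kernel description R_duality phi_P_exact (g := g).
      exact: (f_equal (fun h : dual M => linmap_fun h v) g0).
    by exists (dot c); apply: linmap_ext => u; rewrite gE.
  apply: linmap_ext => v /=.
  have -> : P (phi v) = mzero by apply/phi_P_exact; exists v.
  exact: linmap0 h.
have dual_surj : surjective (dual_map phi).
  move=> f.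
  have [g gE] := extend_functional description R_duality phi_injective phi_P_exact f.
  by exists g; apply: linmap_ext.
by split; last apply: fp_module_of_duals dual_exact dual_surj.
Qed.
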